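(* Let $K$ be a family of $k$-means instances. Let $\mathcal{A}$ be an algorithm that, given an instance in $K$, oracle access to same-cluster queries for some fixed optimal clustering $\mathcal{O}$, and parameters $(\epsilon,\delta)\in(0,1)^2$, outputs a clustering that, with probability at least $1-\delta$, is $(1-\epsilon)$-accurate with respect to $\mathcal{O}$ (correctly labels, up to a permutation of cluster labels, at least a $(1-\epsilon)$ fraction of the points). Then: (1) If $K$ is the family of $k$-means instances in $r$-dimensional Euclidean space that have no boundary points, $\mathcal{A}$ must make $\Omega(r)$ same-cluster queries. (2) If $K$ is the family of finite metric space $k$-means instances that have no boundary points, $\mathcal{A}$ must make $\Omega(\log|Q|)$ same-cluster queries.
   Context: A $k$-means instance $(P,Q,\operatorname{d})$: $P$ a finite set of $n$ points, $Q$ a set of candidate centers, $\operatorname{d}$ a metric on $P\cup Q$. In the Euclidean case $P\subset\mathbb{R}^r$, $Q=\mathbb{R}^r$, $\operatorname{d}$ Euclidean; in the finite metric space case $(P\cup Q,\operatorname{d})$ is a finite metric space. A $k$-clustering is a labeling $f:P\to[k]$ with clusters $C_i=f^{-1}(i)$, centers $c_i=\arg\min_{q\in Q}\sum_{p\in C_i}\operatorname{d}(p,q)^2$, and cost $\sum_i\sum_{p\in C_i}\operatorname{d}(p,c_i)^2$; an optimal clustering minimizes the cost. The instance has no boundary points if in every optimal clustering with clusters $O_i$ and centers $o_i$, each $p\in O_i$ has $\operatorname{d}(p,o_i)<\operatorname{d}(p,o_j)$ for all $j\ne i$. A same-cluster query on $(x,y)$ answers whether $x$ and $y$ are in the same cluster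 of $\mathcal{O}$. A clustering $\mathcal{C}$ is $(1-\alpha)$-accurate w.r.t. $\mathcal{O}$ if $\min_\sigma|\{p: f_{\mathcal{O}}(p)\neq\sigma(f_{\mathcal{C}}(p))\}|\le\alpha n$, minimum over permutations $\sigma$ of $[k]$. *)

(* Defs.v *)
From HB Require Import structures.
From mathcomp Require Import all_boot all_order all_algebra all_fingroup finmap.
From mathcomp Require Import all_classical all_reals all_analysis.
From mathcomp Require Import ring lra.

Set Implicit Arguments.
Unset Strict Implicit.
Unset Printing Implicit Defensive.
Import Order.TTheory GRing.Theory Num.Theory.

Local Open Scope classical_set_scope.
Local Open Scope ring_scope.

Definition metric_on (R : realType) (T : Type) (D : set T) (d : T -> T -> R) :=
  [/\ forall x y, D x -> D y -> 0 <= d x y,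
      forall x y, D x -> D y -> (d x y = 0 <-> x = y),
      forall x y, D x -> D y -> d x y = d y x
    & forall x y z, D x -> D y -> D z -> d x z <= d x y + d y z].

(* The ambient type [space] only serves to host P and Q: nothing is required
   of [dist] outside P `|` Q. *)
Record instance (R : realType) := Instance {
  space : choiceType;
  points : {fset space};
  candidates : set space;
  dist : space -> space -> R;
  nclusters : nat;
  nclusters_gt0 : (0 < nclusters)%N;
  dist_metric : metric_on ([set` points] `|` candidates) dist }.

Arguments candidates {R} I _ : rename.

Section Clustering.
Variables (R : realType) (I : instance R).

Definition labeling := {ffun points I -> 'I_(nclusters I)}.

Implicit Types (f g : labeling) (c : 'I_(nclusters I) -> space I).

Definition cluster_cost f i (q : space I) : R :=
  \sum_(p | f p == i) dist (val p) q ^+ 2.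

(* c i is in argmin_(q in Q); any minimizer is allowed, and any candidate is a
   center of an empty cluster. *)
Definition are_centers f c := forall i,
  candidates I (c i) /\
  forall q, candidates I q -> cluster_cost f i (c i) <= cluster_cost f i q.

Definition cost f c : R := \sum_i cluster_cost f i (c i).

Definition optimal_with f c :=
  are_centers f c /\ forall g c', are_centers g c' -> cost f c <= cost g c'.

Definition optimal f := exists c, optimal_with f c.

Definition no_boundary := forall f c, optimal_with f c ->
  forall p j, j != f p -> dist (val p) (c (f p)) < dist (val p) (c j).

Definition same_cluster f (x y : points I) : bool := f x == f y.

Definition mistakes f g (s : 'S_(nclusters I)) : nat := #|[pred p | f p != s (g p)]|.

(* The default value #|P| of the minimum bounds every number of mistakes. *)
Definition min_mistakes f g : nat :=
  \big[minn/#|` points I|]_(s : 'S_(nclusters I)) mistakes f g s.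

(* accurate alpha f g: g is (1 - alpha)-accurate with respect to f. *)
Definition accurate (alpha : R) f g : Prop :=
  (min_mistakes f g)%:R <= alpha * #|` points I|%:R.

End Clustering.

Section Euclidean.
Variables (R : realType) (r : nat).

Definition edist (x y : 'rV[R]_r) : R :=
  Num.sqrt (\sum_i (x ord0 i - y ord0 i) ^+ 2).

Let cauchy_schwarz (a b : 'I_r -> R) :
  (\sum_i a i * b i) ^+ 2 <= (\sum_i a i ^+ 2) * (\sum_i b i ^+ 2).
Proof.
have : 0 <= \sum_i \sum_j (a i * b j - a j * b i) ^+ 2.
  by apply: sumr_ge0 => i _; apply: sumr_ge0 => j _; apply: sqr_ge0.
have -> : \sum_i \sum_j (a i * b j - a j * b i) ^+ 2 =
    2 * ((\sum_i a i ^+ 2) * (\sum_i b i ^+ 2)) - 2 * (\sum_i a i * b i) ^+ 2.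
  have E (u v : 'I_r -> R) :
    \sum_i \sum_j u i * v j = (\sum_i u i) * (\sum_i v i).
    by rewrite mulr_suml; apply: eq_bigr => i _; rewrite mulr_sumr.
  transitivity (\sum_i \sum_j ((a i ^+ 2 * b j ^+ 2 + b i ^+ 2 * a j ^+ 2)
      - 2 * ((a i * b i) * (a j * b j)))).
    by apply: eq_bigr => i _; apply: eq_bigr => j _; ring.
  under eq_bigr do rewrite big_split sumrN /= -mulr_sumr big_split /=.
  by rewrite big_split sumrN /= -mulr_sumr big_split /= !E; ring.
by lra.
Qed.

Lemma edist_metric (D : set 'rV[R]_r) : metric_on D edist.
Proof.
have S (u : 'I_r -> R) : 0 <= \sum_i u i ^+ 2.
  by apply: sumr_ge0 => i _; apply: sqr_ge0.
split=> [x y _ _|x y _ _|x y _ _|x y z _ _ _]; rewrite /edist.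
- exact: sqrtr_ge0.
- split=> [/eqP|->]; last first.
    by rewrite big1 ?sqrtr0// => i _; rewrite subrr expr0n.
  rewrite sqrtr_eq0 => le0.
  have /eqP : \sum_i (x ord0 i - y ord0 i) ^+ 2 = 0.
    by apply/eqP; rewrite eq_le le0 S.
  rewrite psumr_eq0 => [/allP h|i _]; last exact: sqr_ge0.
  apply/rowP => i; apply/eqP; rewrite -subr_eq0 -sqrf_eq0.
  by apply: h; rewrite mem_index_enum.
- by congr Num.sqrt; apply: eq_bigr => i _; rewrite -sqrrN opprB.
- set a := fun i => x ord0 i - y ord0 i; set b := fun i => y ord0 i - z ord0 i.
  rewrite -(@ler_pXn2r _ 2)// ?nnegrE ?addr_ge0 ?sqrtr_ge0//.
  rewrite sqrrD !sqr_sqrtr ?S//.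
  have -> : \sum_i (x ord0 i - z ord0 i) ^+ 2 =
      \sum_i a i ^+ 2 + 2 * (\sum_i a i * b i) + \sum_i b i ^+ 2.
    rewrite mulr_sumr -!big_split /=; apply: eq_bigr => i _.
    by rewrite /a /b; ring.
  have : \sum_i a i * b i <=
      Num.sqrt (\sum_i a i ^+ 2) * Num.sqrt (\sum_i b i ^+ 2).
    by rewrite -sqrtrM ?S// (le_trans (ler_norm _))// -sqrtr_sqr ler_wsqrtr//
      cauchy_schwarz.
  by rewrite -mulr_natl; lra.
Qed.

Definition euclidean_instance (P : {fset 'rV[R]_r}) k (k_gt0 : (0 < k)%N) :=
  @Instance R _ P [set: 'rV[R]_r] edist k k_gt0 (@edist_metric _).

End Euclidean.

Definition family (R : realType) := instance R -> Prop.

Definition euclidean_family (R : realType) (r : nat) : family R := fun I =>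
  (exists P k (k_gt0 : (0 < k)%N), I = @euclidean_instance R r P k k_gt0) /\
  no_boundary I.

Definition finite_metric_family (R : realType) : family R := fun I =>
  finite_set (candidates I) /\ no_boundary I.

(* A deterministic adaptive query strategy: each query (x, y) is followed by a
   continuation depending on the oracle's answer. *)
Inductive strategy (X Y : Type) :=
| Output of Y
| Query of X & X & (bool -> strategy X Y).

Arguments Output {X Y}.
Arguments Query {X Y}.

Section Run.
Variables (X Y : Type) (oracle : X -> X -> bool).

Fixpoint output (t : strategy X Y) : Y :=
  match t with
  | Output y => y
  | Query x x' next => output (next (oracle x x'))
  end.

Fixpoint queries (t : strategy X Y) : nat :=
  match t with
  | Output _ => 0%N
  | Query x x' next => (queries (next (oracle x x'))).+1
  end.

End Run.

(* A randomized strategy is a random deterministic one, the seed (internal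
   randomness) being drawn from an arbitrary probability space. *)
Record randomized (R : realType) (X Y : Type) := Randomized {
  disp : measure_display;
  seed : measurableType disp;
  seed_prob : probability seed R;
  strat : seed -> strategy X Y;
  measurable_output : forall (o : X -> X -> bool) y,
    measurable [set w | output o (strat w) = y];
  measurable_queries : forall (o : X -> X -> bool) m,
    measurable [set w | queries o (strat w) = m] }.

(* An algorithm maps an instance and parameters (epsilon, delta) to a
   randomized strategy; no computability is required. *)
Definition algorithm (R : realType) :=
  forall I : instance R, R -> R -> randomized R (points I) (labeling I).

Section Algorithm.
Variables (R : realType) (A : algorithm R).

Definition success (I : instance R) (eps delta : R) (O : labeling I) :
    set (seed (A I eps delta)) :=
  [set w | accurate eps O (output (same_cluster O) (strat w))].

Arguments success {I} eps delta O.

Definition learns (K : family R) := forall (I : instance R) (O : labeling I),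
  K I -> optimal O ->
  forall eps delta : R, 0 < eps < 1 -> 0 < delta < 1 ->
  ((1 - delta)%:E <= seed_prob (A I eps delta) (success eps delta O))%E.

(* With positive probability, at least b queries are made when the oracle
   answers according to O. *)
Definition may_query (I : instance R) (eps delta : R) (O : labeling I) (b : R) :=
  (0 < seed_prob (A I eps delta)
         [set w | (b <= (queries (same_cluster O) (strat w))%:R)%R])%E.

End Algorithm.

(* Main.v *)
(* Take for points the [n] vertices of a regular simplex in [R^n], with [k]
   constant. A cluster of size [s > 0] costs [s - 1] whatever its members, so
   every labeling using all [k] labels is optimal; its points are at squared
   distance [1 - 1/s] from their own center and [1 + 1/s'] from the others,
   hence there are no boundary points. Only the centroids of the [2 ^ n] sets of
   vertices matter as candidates, so the candidates may be all of [R^n] or any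
   finite set containing these, which gives [n] of order [ln N].
   At least [k ^ (n - k)] labelings are optimal. By Markov's inequality for
   [k ^ agreement], a fixed output is accurate for at most
   [k! * (2 * k) ^ n / 8 ^ n] of them once [k = 8 ^ q] and [q * (1 - eps) >= 1],
   and a strategy asking at most [n] queries has at most [2 ^ n] outputs.
   Averaging the success probabilities over the labelings yields a contradiction
   when [n] is large. *)

Require Import Defs.
From HB Require Import structures.
From mathcomp Require Import all_boot all_order all_algebra all_fingroup finmap.
From mathcomp Require Import all_classical all_reals all_analysis.
From mathcomp Require Import measurable_realfun ring lra zify.

Set Implicit Arguments.
Unset Strict Implicit.
Unset Printing Implicit Defensive.
Import Order.TTheory GRing.Theory Num.Theory.

Local Open Scope classical_set_scope.
Local Open Scope ring_scope.

(** * Counting labelings and query strategies *)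

Lemma card_exists_le (S T : finType) (P : S -> T -> bool) M :
  (forall s, #|[pred t | P s t]| <= M)%N ->
  (#|[pred t | [exists s, P s t]]| <= #|S| * M)%N.
Proof.
move=> PM; rewrite -sum1_card (@leq_trans (\sum_s \sum_(t | P s t) 1)%N)//.
  rewrite (exchange_big_dep predT)//= big_mkcond leq_sum// => t _.
  case: ifP => // /existsP[s Pst].
  by rewrite sum1_card; apply/card_gt0P; exists s.
rewrite -sum_nat_const leq_sum// => s _.
by rewrite (leq_trans _ (PM s))// sum1_card.
Qed.

Section Agreement.
Variables (T : finType) (k : nat).
Implicit Types f h : {ffun T -> 'I_k}.

Definition agreement f h : nat := #|[pred p | f p == h p]|.

(** The weight is a product over the points, so the sum over [f] factors; each factor is
    [k + (k - 1)]. *)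
Lemma sum_exp_agreement h :
  (\sum_f k ^ agreement f h <= (2 * k) ^ #|T|)%N.
Proof.
have prodE f : (k ^ agreement f h = \prod_p (if f p == h p then k else 1))%N.
  by rewrite -big_mkcond prod_nat_const.
under eq_bigr do rewrite prodE.
rewrite -(bigA_distr_bigA (fun p i => if i == h p then k else 1%N)) /=.
rewrite -[X in (_ <= X)%N]prod_nat_const; apply: leq_prod => p _.
rewrite (bigD1 (h p))//= eqxx mul2n -addnn leq_add2l.
rewrite (eq_bigr (fun=> 1%N)) => [|i /negPf ->//].
by rewrite sum1_card (leq_trans (max_card _))// card_ord.
Qed.

(* Markov's inequality for the exponential moment [k ^ agreement]. *)
Lemma card_agreement b q h : (0 < b)%N -> k = (b ^ q)%N ->
  (#|[pred f : {ffun T -> 'I_k} | #|T| <= q * agreement f h]| * b ^ #|T|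
    <= (2 * k) ^ #|T|)%N.
Proof.
move=> b0 kE; apply: leq_trans (sum_exp_agreement h).
rewrite -sum_nat_const.
rewrite [X in (_ <= X)%N](bigID [pred f | #|T| <= q * agreement f h]%N) /=.
apply: leq_trans (leq_addr _ _); apply: leq_sum => f /= hf.
(* As [k = b ^ q], the event forces [b ^ #|T| <= k ^ agreement f h]. *)
by rewrite [X in (_ <= X ^ _)%N]kE -expnM leq_pexp2l.
Qed.

End Agreement.

Section Accuracy.
Variables (R : realType) (I : instance R).
Implicit Types f g : labeling I.

Lemma min_mistakes_attained f g :
  exists s, (mistakes f g s <= min_mistakes f g)%N.
Proof.
rewrite /min_mistakes; elim/big_rec: _ => [|s x _ [s' s'x]].
  (* The default value is the number of points, which bounds the mistakes of the identity. *)
  by exists 1%g; rewrite cardfE max_card.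
by rewrite /minn; case: ifP => _; [exists s | exists s'].
Qed.

(** With [a] agreements and [m] mistakes under a best permutation, [m <= eps * (a + m)] gives
    [(1 - eps) * (a + m) <= a]; multiply by [q]. *)
Lemma accurate_agreement (eps : R) q f g :
  1 <= q%:R * (1 - eps) -> accurate eps f g ->
  exists s : 'S_(nclusters I),
    (#|{: points I}| <= q * agreement f [ffun p => s (g p)])%N.
Proof.
move=> q1 fg; have [s sm] := min_mistakes_attained f g; exists s.
have := cardC [pred p | f p == s (g p)].
rewrite (eq_card (_ : [predC _] =i [pred p | f p != s (g p)])) //.
rewrite -[#|[pred p | f p != _]|]/(mistakes f g s).
set a := #|_|; have -> : agreement f [ffun p => s (g p)] = a.
  by apply: eq_card => p; rewrite !inE ffunE.
move=> aE; move: fg; rewrite /accurate cardfE -aE => fg.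
have {}fg : (mistakes f g s)%:R <= eps * (a + mistakes f g s)%:R.
  by apply: le_trans fg; rewrite ler_nat.
rewrite -(ler_nat R) natrM.
have q0 : (0 : R) <= q%:R by [].
have a0 : (0 : R) <= (a + mistakes f g s)%:R by [].
apply: (@le_trans _ _ (q%:R * (1 - eps) * (a + mistakes f g s)%:R)).
  by rewrite ler_peMl.
rewrite -mulrA ler_wpM2l// mulrBl mul1r lerBlDr natrD.
by rewrite natrD in fg; lra.
Qed.

(** Union bound over the permutations of the labels, with Markov's inequality for each relabeling of
    [g]. *)
Lemma card_accurate b q (eps : R) g : (0 < b)%N -> nclusters I = (b ^ q)%N ->
  1 <= q%:R * (1 - eps) ->
  (#|[pred f | `[< accurate eps f g >]]| * b ^ #|{: points I}|
    <= (nclusters I)`! * (2 * nclusters I) ^ #|{: points I}|)%N.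
Proof.
move=> b0 kE q1; rewrite -leq_divRL ?expn_gt0 ?b0//.
apply: (@leq_trans ((nclusters I)`! *
  ((2 * nclusters I) ^ #|{: points I}| %/ b ^ #|{: points I}|))%N); last first.
  by rewrite leq_divRL ?expn_gt0 ?b0// -mulnA leq_mul2l leq_trunc_div orbT.
rewrite -card_Sn.
pose P (s : 'S_(nclusters I)) (f : labeling I) :=
  (#|{: points I}| <= q * agreement f [ffun p => s (g p)])%N.
apply: (@leq_trans #|[pred f | [exists s, P s f]]|).
  apply/subset_leq_card/fintype.subsetP => f; rewrite !inE => fg.
  by apply/existsP; exact: accurate_agreement q1 fg.
apply: card_exists_le => s; rewrite leq_divRL ?expn_gt0 ?b0//.
exact: card_agreement.
Qed.

End Accuracy.

Section Strategy.
Variables (X Y : Type) (I : finType) (oracle : I -> X -> X -> bool).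
Variables (acc : I -> Y -> bool) (M : nat).
Hypothesis card_acc : forall y, (#|[pred i | acc i y]| <= M)%N.

(** Induction on the strategy: a query splits [S] by the oracle's answer, and each half follows a
    single continuation with one query less to spend. A leaf has one output, accepted by at most [M]
    indices. *)
Lemma card_strategy (t : strategy X Y) b (S : {pred I}) :
  (#|[pred i | [&& S i, queries (oracle i) t <= b &
       acc i (output (oracle i) t)]]| <= 2 ^ b * M)%N.
Proof.
elim: t b S => [y|x x' next IH] b S /=.
  apply: leq_trans (leq_trans (card_acc y) _).
    2: by rewrite leq_pmull ?expn_gt0.
  by apply/subset_leq_card/fintype.subsetP => i; rewrite !inE => /andP[].
case: b => [|b]; first by rewrite eq_card0// => i; rewrite !inE andbF.
rewrite -(cardID [pred i | oracle i x x']) expnS -mulnA mul2n -addnn.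
apply: leq_add.
  apply: leq_trans (IH true b [pred i | S i && oracle i x x']).
  apply/subset_leq_card/fintype.subsetP => i; rewrite !inE /=.
  by case: (oracle i x x') => /=; rewrite ?andbF ?andbT.
apply: leq_trans (IH false b [pred i | S i && ~~ oracle i x x']).
apply/subset_leq_card/fintype.subsetP => i; rewrite !inE /=.
by case: (oracle i x x') => /=; rewrite ?andbF ?andbT.
Qed.

End Strategy.

(** Integrate over [w] the number of [i] with [w] in [U i]: the integral is at least [p * #|I|], the
    integrand at most [K]. *)
Lemma card_le_of_probability_ge (R : realType) d (T : measurableType d)
    (P : probability T R) (I : finType) (U : I -> set T) (p : R) (K : nat) :
  (forall i, measurable (U i)) -> (forall i, p%:E <= P (U i))%E ->
  (forall w, #|[pred i | w \in U i]| <= K)%N -> p * #|I|%:R <= K%:R.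
Proof.
move=> mU pU UK; rewrite -lee_fin.
apply: (@le_trans _ _ (\sum_i P (U i))%E).
  rewrite mulr_natr -sumr_const -sumEFin.
  by apply: lee_sum => i _.
have -> : (\sum_i P (U i) = \int[P]_w (\sum_i (\1_(U i) w)%:E))%E.
  rewrite ge0_integral_sum//; last first.
    by move=> i; apply/measurable_EFinP/measurable_indic.
  by apply: eq_bigr => i _; rewrite integral_indic// setIT.
apply: (@le_trans _ _ (\int[P]_w K%:R%:E)%E); last first.
  by rewrite integral_cst// [X in (_ * X)%E](@probability_setT _ _ _ P) mule1.
apply: ge0_le_integral => //.
- by move=> w _; apply: sume_ge0 => i _; rewrite lee_fin.
- by apply: emeasurable_sum => i; apply/measurable_EFinP/measurable_indic.
move=> w _; rewrite sumEFin lee_fin -natr_sum ler_nat.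
apply: leq_trans (UK w); rewrite -sum1_card [X in (_ <= X)%N]big_mkcond /=.
by apply: leq_sum => i _; rewrite inE; case: (w \in U i).
Qed.

(** * Success and query counts over the random seed *)

Section LowerBound.
Variables (R : realType) (A : algorithm R).

Lemma measurable_success (I : instance R) (eps delta : R) (O : labeling I) :
  measurable (@success R A I eps delta O).
Proof.
rewrite (_ : @success R A I eps delta O =
    \bigcup_(y in [set y | accurate eps O y])
    [set w | output (same_cluster O) (strat w) = y]).
  apply: fin_bigcup_measurable => [|y _]; first exact: finite_finset.
  exact: measurable_output.
apply/seteqP; split=> [w acc|w [y /= acc e]].
  by exists (output (same_cluster O) (strat w)).
by rewrite /success /= e.
Qed.

Lemma measurable_queries_ge (I : instance R) (eps delta : R) (O : labeling I)
    (b : R) :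
  measurable [set w : seed (A I eps delta) |
    b <= (queries (same_cluster O) (strat w))%:R].
Proof.
rewrite (_ : [set w | _] = \bigcup_(m in [set m | b <= m%:R])
    [set w | queries (same_cluster O) (strat w) = m]).
  by apply: bigcup_measurable => m _; exact: measurable_queries.
apply/seteqP; split=> [w ge|w [m /= ge e]].
  by exists (queries (same_cluster O) (strat w)).
by rewrite /= e.
Qed.

(** By contraposition: if reaching [b] queries has probability zero under every [O t], discarding
    those seeds keeps the success probabilities. A fixed seed gives a deterministic strategy, which
    succeeds with fewer than [b] queries for at most [2 ^ b * M] of the [t]. *)
Lemma may_query_of_card (I : instance R) (eps delta : R) (T : finType)
    (O : T -> labeling I) (b M : nat) :
  (forall t, ((1 - delta)%:E <=
    seed_prob (A I eps delta) (@success R A I eps delta (O t)))%E) ->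
  (forall y, #|[pred t | `[< accurate eps (O t) y >]]| <= M)%N ->
  (2 ^ b * M)%:R < (1 - delta) * #|T|%:R ->
  exists t, may_query A eps delta (O t) b%:R.
Proof.
move=> succ cardM; apply: contraPP => /forallNP none.
apply/negP; rewrite -leNgt.
pose B t := [set w : seed (A I eps delta) |
  b%:R <= (queries (same_cluster (O t)) (strat w))%:R :> R].
have mB t : measurable (B t) by exact: measurable_queries_ge.
have mS t := @measurable_success I eps delta (O t).
have B0 t : seed_prob (A I eps delta) (B t) = 0%E.
  by apply/eqP; rewrite eq_le measure_ge0 andbT leNgt; apply/negP; exact: none.
apply: (@card_le_of_probability_ge _ _ _ (seed_prob (A I eps delta)) T
  (fun t => @success R A I eps delta (O t) `\` B t)).
- by move=> t; exact: measurableD.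
- move=> t; apply: le_trans (succ t) _.
  rewrite (measureDI _ (mS t) (mB t)).
  have mSB := measurableI _ _ (mS t) (mB t).
  by rewrite (subset_measure0 mSB (mB t) _ (B0 t)) ?adde0 ?lexx//.
move=> w; apply: leq_trans (card_strategy
  (fun t => same_cluster (O t)) cardM (strat w) b predT).
apply/subset_leq_card/fintype.subsetP => t; rewrite !inE /= => -[acc nB].
apply/andP; split; last exact/asboolP.
by rewrite leqNgt; apply/negP => lt; apply: nB; rewrite /B/= ler_nat ltnW.
Qed.

End LowerBound.

(** * The regular simplex *)

(* [edist] alone would be the extended distance of MathComp-Analysis. *)
Local Notation edist := Defs.edist.

Section Simplex.
Variables (R : realType) (n : nat).
Implicit Types (A B : {set 'I_n}) (q : 'rV[R]_n).

Definition vertex (i : 'I_n) : 'rV[R]_n := delta_mx ord0 i.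

Definition simplex : {fset 'rV[R]_n} := [fset vertex i | i in 'I_n]%fset.

Lemma vertex_inj : injective vertex.
Proof.
move=> i j /rowP/(_ i); rewrite !mxE !eqxx /=.
by case: eqVneq => //= _ /eqP; rewrite oner_eq0.
Qed.

Lemma vertex_simplex i : vertex i \in simplex.
Proof. by apply/imfsetP; exists i. Qed.

Definition vert (i : 'I_n) : simplex := [` vertex_simplex i]%fset.

Lemma vert_bij : bijective vert.
Proof.
apply: inj_card_bij => [i j /(congr1 val)|]; first exact: vertex_inj.
by rewrite -cardfE card_imfset ?cardE//; exact: vertex_inj.
Qed.

Lemma vert_codom p : p \in codom vert.
Proof. by have [g _ gK] := vert_bij; rewrite -[p]gK codom_f. Qed.

Lemma vert_surj p : exists i, p = vert i.
Proof. by exists (iinv (vert_codom p)); rewrite f_iinv. Qed.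

Lemma card_simplex : #|{: simplex}| = n.
Proof. by rewrite -(bij_eq_card vert_bij) card_ord. Qed.

(* Division by [#|A| = 0] makes the centroid of the empty set the origin. *)
Definition centroid A : 'rV[R]_n := \row_j ((j \in A)%:R / #|A|%:R).

Definition sqnorm q : R := \sum_j q ord0 j ^+ 2.

Lemma edist_sqr (x y : 'rV[R]_n) : edist x y ^+ 2 = sqnorm (x - y).
Proof.
rewrite sqr_sqrtr; last by apply: sumr_ge0 => i _; exact: sqr_ge0.
by apply: eq_bigr => i _; rewrite !mxE.
Qed.

Lemma edist_xx q : edist q q = 0.
Proof. by rewrite /edist big1 ?sqrtr0// => i _; rewrite subrr expr0n. Qed.

Lemma sqnorm_ge0 q : 0 <= sqnorm q.
Proof. by apply: sumr_ge0 => i _; exact: sqr_ge0. Qed.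

Lemma sqnorm_eq0 q : sqnorm q = 0 -> q = 0.
Proof.
move=> /eqP; rewrite psumr_eq0 => [/allP h|i _]; last exact: sqr_ge0.
apply/rowP => i; apply/eqP; rewrite mxE -sqrf_eq0.
by apply: h; rewrite mem_index_enum.
Qed.

Lemma vertex_edist i q :
  edist (vertex i) q ^+ 2 = 1 - 2 * q ord0 i + sqnorm q.
Proof.
rewrite edist_sqr /sqnorm (bigD1 i)//= [in RHS](bigD1 i)//= !mxE !eqxx /=.
rewrite (eq_bigr (fun j => q ord0 j ^+ 2)); first by ring.
by move=> j ji; rewrite !mxE eqxx (negPf ji) /= add0r sqrrN.
Qed.

Lemma sqnorm_centroid A : (0 < #|A|)%N -> sqnorm (centroid A) = #|A|%:R^-1.
Proof.
move=> A0; have cA : #|A|%:R != 0 :> R by rewrite pnatr_eq0 -lt0n.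
rewrite /sqnorm (bigID (mem A))/= [X in _ + X]big1 => [|j /negPf jA].
  2: by rewrite !mxE jA mul0r expr0n.
rewrite (eq_bigr (fun=> #|A|%:R ^- 2)) => [|j /= jA]; last first.
  by rewrite !mxE jA mul1r exprVn.
by rewrite sumr_const addr0 -mulr_natl; field.
Qed.

(** Parallel axis identity; the scatter around the centroid is [#|A| - 1], and the boolean term
    covers the empty set. *)
Lemma sum_vertex_edist A q : \sum_(i in A) edist (vertex i) q ^+ 2 =
  #|A|%:R - (0 < #|A|)%N%:R + #|A|%:R * edist q (centroid A) ^+ 2.
Proof.
have [A0|A0] := posnP #|A|.
  by rewrite A0 subr0 add0r mul0r (cards0_eq A0) big_set0.
have cA : #|A|%:R != 0 :> R by rewrite pnatr_eq0 -lt0n.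
have -> : edist q (centroid A) ^+ 2 = sqnorm q
    - 2 * (\sum_(i in A) q ord0 i) / #|A|%:R + sqnorm (centroid A).
  rewrite edist_sqr.
  rewrite -mulrA mulr_suml mulr_sumr (big_mkcond (mem A)) /sqnorm.
  rewrite -sumrN -!big_split /=.
  apply: eq_bigr => j _; rewrite !mxE.
  by case: (j \in A) => /=; ring.
rewrite sqnorm_centroid// (eq_bigr _ (fun i _ => vertex_edist i q)).
rewrite !big_split /= !sumr_const sumrN -mulr_sumr -[sqnorm q *+ _]mulr_natl.
by field.
Qed.

(** The squared distances are [1 - 1 / #|A|] and [1 + 1 / #|B|]. *)
Lemma edist_centroid_lt A B i : i \in A -> i \notin B -> (0 < #|B|)%N ->
  edist (vertex i) (centroid A) < edist (vertex i) (centroid B).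
Proof.
move=> iA iB B0; have A0 : (0 < #|A|)%N by apply/card_gt0P; exists i.
rewrite -(@ltr_pXn2r _ 2)// ?nnegrE ?sqrtr_ge0// !vertex_edist.
rewrite !sqnorm_centroid// !mxE iA (negPf iB) /=.
have : 0 < #|A|%:R^-1 :> R by rewrite invr_gt0 ltr0n.
have : 0 < #|B|%:R^-1 :> R by rewrite invr_gt0 ltr0n.
by lra.
Qed.

Section Instance.
Variables (Q : set 'rV[R]_n) (k : nat) (k_gt0 : (0 < k)%N).

Definition simplex_instance : instance R :=
  @Instance R _ simplex Q (@edist R n) k k_gt0 (@edist_metric _ _ _).

Hypothesis Q_centroid : forall A, Q (centroid A).

Implicit Types (f : labeling simplex_instance).

Definition cluster f (i : 'I_k) : {set 'I_n} := [set j | f (vert j) == i]%SET.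

Lemma cluster_costE f (i : 'I_k) q :
  cluster_cost f i q = #|cluster f i|%:R - (0 < #|cluster f i|)%N%:R
    + #|cluster f i|%:R * edist q (centroid (cluster f i)) ^+ 2.
Proof.
rewrite /cluster_cost (reindex vert)/=; last exact: onW_bij vert_bij.
by rewrite -sum_vertex_edist; apply: eq_bigl => j; rewrite inE.
Qed.

(** By the parallel axis identity the centroid, itself a candidate, is the only minimizer for a
    nonempty cluster; for an empty one the cost vanishes everywhere. *)
Lemma are_centersP f c : are_centers f c <-> forall i : 'I_k,
  Q (c i) /\ ((0 < #|cluster f i|)%N -> c i = centroid (cluster f i)).
Proof.
split=> h i; have [Qi hi] := h i; split=> //.
  move=> Ci; have := hi _ (Q_centroid (cluster f i)).
  rewrite !cluster_costE edist_xx expr0n mulr0 addr0 gerDl.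
  rewrite pmulr_rle0 ?ltr0n// edist_sqr => le0.
  by apply/subr0_eq/sqnorm_eq0/eqP; rewrite eq_le le0 sqnorm_ge0.
move=> q _; rewrite !cluster_costE lerD2l.
have [->|/hi ->] := posnP #|cluster f i|; first by rewrite !mul0r.
by rewrite edist_xx expr0n mulr0 mulr_ge0// sqr_ge0.
Qed.

Definition nonempty_clusters f : {set 'I_k} :=
  [set i | (0 < #|cluster f i|)%N]%SET.

Lemma costE f c : are_centers f c ->
  cost f c = n%:R - #|nonempty_clusters f|%:R.
Proof.
move=> /are_centersP h; rewrite /cost.
rewrite (eq_bigr (fun i =>
    #|cluster f i|%:R - (0 < #|cluster f i|)%N%:R)) => [|i _]; last first.
  rewrite cluster_costE; have [->|/(proj2 (h i)) ->] := posnP #|cluster f i|.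
    by rewrite mul0r addr0.
  by rewrite edist_xx expr0n mulr0 addr0.
rewrite big_split sumrN /= -!natr_sum; congr (_%:R - _%:R).
  under eq_bigr do rewrite -sum1_card.
  rewrite -[RHS]card_ord -sum1_card.
  rewrite [RHS](partition_big (fun j => f (vert j)) predT) //=.
  by apply: eq_bigr => i _; apply: eq_bigl => j; rewrite inE.
by rewrite -sum1dep_card [RHS]big_mkcond; apply: eq_bigr => i _; case: ltnP.
Qed.

Lemma nonempty_full f : (k <= #|nonempty_clusters f|)%N ->
  forall i, (0 < #|cluster f i|)%N.
Proof.
move=> le i; suff: i \in nonempty_clusters f by rewrite inE.
have /eqP -> : nonempty_clusters f == setTfor 'I_k.
  rewrite -finset.subTset -(geq_leqif (subset_leqif_card (finset.subsetT _))).
  by rewrite cardsT card_ord.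
by rewrite inE.
Qed.

(** By [costE] no cost is below [n - k], and using all labels attains it. *)
Lemma surjective_optimal f : (forall i, (0 < #|cluster f i|)%N) -> optimal f.
Proof.
move=> f_surj; exists (fun i => centroid (cluster f i)).
have cen : are_centers f (fun i => centroid (cluster f i)).
  by apply/are_centersP => i; split.
split=> // g c' gc'; rewrite !costE// lerD2l lerN2 ler_nat.
apply: (@leq_trans k); first by rewrite -[X in (_ <= X)%N]card_ord max_card.
rewrite -[X in (X <= _)%N]card_ord; apply: subset_leq_card.
by apply/fintype.subsetP => i _; rewrite inE.
Qed.

Definition labeling_of (u : 'I_n -> 'I_k) : labeling simplex_instance :=
  [ffun p => u (iinv (vert_codom p))].

Lemma labeling_ofE u j : labeling_of u (vert j) = u j.
Proof.
by rewrite ffunE; congr u; apply: (bij_inj vert_bij); rewrite f_iinv.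
Qed.

Variables (m : nat) (n_km : n = (k + m)%N).

(* The first [k] vertices get distinct labels, so that no cluster is empty,
   and [w] labels the others freely. *)
Definition hard_labeling (w : {ffun 'I_m -> 'I_k}) :
    labeling simplex_instance :=
  labeling_of (fun j =>
    match fintype.split (cast_ord n_km j) with inl i => i | inr l => w l end).

Lemma hard_labeling_nonempty w i : (0 < #|cluster (hard_labeling w) i|)%N.
Proof.
apply/card_gt0P; exists (cast_ord (esym n_km) (unsplit (inl i))).
by rewrite inE labeling_ofE cast_ordKV unsplitK.
Qed.

Lemma hard_labeling_inj : injective hard_labeling.
Proof.
move=> w w' /ffunP e; apply/ffunP => l.
have := e (vert (cast_ord (esym n_km) (unsplit (inr l)))).
by rewrite !labeling_ofE cast_ordKV unsplitK.
Qed.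

Lemma hard_labeling_optimal w : optimal (hard_labeling w).
Proof. exact/surjective_optimal/hard_labeling_nonempty. Qed.

Lemma optimal_nonempty f c :
  optimal_with f c -> forall i, (0 < #|cluster f i|)%N.
Proof.
move=> [cen opt]; apply: nonempty_full.
pose g := hard_labeling [ffun => Ordinal k_gt0].
have cen' : are_centers g (fun i => centroid (cluster g i)).
  by apply/are_centersP => i; split.
have := opt _ _ cen'; rewrite !costE// lerD2l lerN2 ler_nat.
apply: leq_trans; rewrite -[X in (X <= _)%N]card_ord; apply: subset_leq_card.
by apply/fintype.subsetP => i _; rewrite inE hard_labeling_nonempty.
Qed.

Lemma simplex_no_boundary : no_boundary simplex_instance.
Proof.
move=> f c fc p j jp; have ne := optimal_nonempty fc.
case: fc => /are_centersP cen _.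
rewrite (cen j).2// (cen (f p)).2//.
have [i pE] := vert_surj p; subst p.
apply: edist_centroid_lt => //; rewrite inE ?eqxx//.
by rewrite eq_sym.
Qed.

End Instance.
End Simplex.

(** [n0] and [k] depend on [eps] and [delta] only; [Q] stays free so that the bound serves both
    families. *)
Lemma simplex_lower_bound (R : realType) (eps delta : R) :
  0 < eps < 1 -> 0 < delta < 1 ->
  exists n0 k, exists k_gt0 : (0 < k)%N, forall n, (n0 <= n)%N ->
  forall Q : set 'rV[R]_n, (forall S, Q (centroid R S)) ->
  let I := simplex_instance Q k_gt0 in
  no_boundary I /\
  forall A : algorithm R,
    (forall O : labeling I, optimal O -> ((1 - delta)%:E <=
      seed_prob (A I eps delta) (@success R A I eps delta O))%E) ->
  exists O : labeling I, optimal O /\ may_query A eps delta O n%:R.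
Proof.
move=> /andP[eps0 eps1] /andP[delta0 delta1].
have e1 : 0 < 1 - eps by rewrite subr_gt0.
have d1 : 0 < 1 - delta by rewrite subr_gt0.
(* The base 8 absorbs the 2 of [2 * k] and the 2 of each query's answers, and leaves a spare factor
   [2 ^ n]. *)
pose q := Num.bound (1 - eps)^-1; pose k := (8 ^ q)%N.
have k_gt0 : (0 < k)%N by rewrite expn_gt0.
have q1 : 1 <= q%:R * (1 - eps).
  by rewrite -ler_pdivrMr// mul1r ltW// archi_boundP// invr_ge0 ltW.
pose C := (k`! * k ^ k)%N.
(* [k <= n] leaves room for one vertex per label; the other bound yields
   [C < (1 - delta) * 2 ^ n]. *)
exists (maxn k (Num.bound (C%:R / (1 - delta)))); exists k.
exists k_gt0 => n.
rewrite geq_max => /andP[kn Cn] Q Qcen I.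
have [m nE] : exists m, n = (k + m)%N by exists (n - k)%N; rewrite subnKC.
split; first exact: simplex_no_boundary nE.
move=> A succ.
have [|y||t mq] := @may_query_of_card R A I eps delta {ffun 'I_m -> 'I_k}
    (fun w => hard_labeling Q k_gt0 nE w) n (k`! * (2 * k) ^ n %/ 8 ^ n).
- by move=> t; apply: succ; exact: hard_labeling_optimal.
(* The bound on all accurate labelings passes to the hard ones by injectivity. *)
- rewrite leq_divRL ?expn_gt0//.
  have := @card_accurate R I 8 q eps y isT erefl q1.
  rewrite card_simplex; apply: leq_trans; rewrite leq_mul2r; apply/orP; right.
  rewrite -(card_imset _ (@hard_labeling_inj R n Q k k_gt0 m nE)).
  apply/subset_leq_card/fintype.subsetP => f.
  by move=> /imsetP[w]; rewrite !inE => acc ->.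
(* After clearing [8 ^ n] and cancelling [k ^ m * 4 ^ n], what remains is
   [C < (1 - delta) * 2 ^ n]. *)
- rewrite -(@ltr_pM2r _ (8 ^ n)%:R) ?ltr0n ?expn_gt0// -natrM.
  apply: (@le_lt_trans _ _ (2 ^ n * (k`! * (2 * k) ^ n))%:R).
    by rewrite ler_nat -mulnA leq_mul2l leq_trunc_div orbT.
  have -> : (2 ^ n * (k`! * (2 * k) ^ n) = C * (k ^ m * 4 ^ n))%N.
    rewrite /C (_ : 4 = 2 * 2)%N// !expnMn.
    have -> : (k ^ n = k ^ k * k ^ m)%N by rewrite -expnD nE.
    by lia.
  have -> : (8 ^ n = 2 ^ n * 4 ^ n)%N by rewrite -expnMn.
  rewrite card_ffun !card_ord.
  have -> : (1 - delta) * (k ^ m)%:R * (2 ^ n * 4 ^ n)%:R =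
      (1 - delta) * (2 ^ n)%:R * (k ^ m * 4 ^ n)%:R by rewrite !natrM; ring.
  rewrite natrM ltr_pM2r ?ltr0n ?muln_gt0 ?expn_gt0 ?k_gt0//.
  by rewrite mulrC -ltr_pdivrMr// natrX Num.Theory.upper_nthrootP.
exists (hard_labeling Q k_gt0 nE t); split=> //.
exact: hard_labeling_optimal.
Qed.

(** * Candidate sets of prescribed size and the two families *)

Lemma may_query_le (R : realType) (A : algorithm R) (I : instance R)
    (eps delta : R) (O : labeling I) (b b' : R) :
  b' <= b -> may_query A eps delta O b -> may_query A eps delta O b'.
Proof.
move=> bb' /lt_le_trans; apply.
apply: le_measure; rewrite ?inE; try exact: measurable_queries_ge.
by move=> w /=; exact: le_trans.
Qed.

Lemma fset_superset_card (T : choiceType) (C B : {fset T}) N :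
  (#|` C| <= N <= #|` B|)%N -> exists2 D, (C `<=` D)%fset & #|` D| = N.
Proof.
move=> /andP[+ NB]; move dE : (N - #|` C|)%N => d.
elim: d C dE => [|d IH] C dE CN.
  by exists C => //; apply/eqP; rewrite eqn_leq CN -subn_eq0 dE.
have /fsubsetPn[x xB xC] : ~~ (B `<=` C)%fset.
  by apply/negP => /fsubset_leq_card; lia.
have cD := cardfsU1 x C; rewrite xC /= in cD.
have [||D xCD DN] := IH (x |` C)%fset; rewrite ?cD; [lia|lia|].
by exists D => //; apply: fsubset_trans xCD; exact: fsubsetU1.
Qed.

(** The at most [2 ^ n] centroids are padded to exactly [N] candidates with constant vectors, which
    are distinct because [0 < n]. *)
Lemma centroid_candidates (R : realType) n N : (0 < n)%N -> (2 ^ n <= N)%N ->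
  exists2 D : {fset 'rV[R]_n}, (forall S, centroid R S \in D) & #|` D| = N.
Proof.
move=> n0 nN.
pose C := [fset centroid R S | S in {set 'I_n}]%fset.
pose B := [fset (const_mx (i : nat)%:R : 'rV[R]_n) | i : 'I_N in 'I_N]%fset.
have [|D CD DN] := @fset_superset_card _ C B N.
  apply/andP; split.
    apply: leq_trans (leq_imfset_card _ _ _) _.
    by rewrite -cardE -cardsT -powersetT card_powerset cardsT card_ord.
  rewrite card_imfset => [|i j /matrixP/(_ ord0 (Ordinal n0))].
    by rewrite -cardE card_ord.
  by rewrite !mxE => /eqP; rewrite eqr_nat => /eqP/val_inj.
exists D => // S; apply: (fsubsetP CD).
by apply/imfsetP; exists S.
Qed.

(** With [n] the truncated logarithm, [N < 2 ^ n.+1] and [ln 2 <= 1] give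
    [ln N <= n + 1 <= 2 * n]. *)
Lemma half_ln_le_trunc_log (R : realType) N : (2 <= N)%N ->
  2^-1 * ln N%:R <= (trunc_log 2 N)%:R :> R.
Proof.
move=> N2; set n := trunc_log 2 N.
have n1 : (1 <= n)%N by apply: trunc_log_max.
have : ln N%:R <= n.+1%:R :> R.
  apply: (@le_trans _ _ (ln (2 ^+ n.+1))).
    rewrite ler_ln ?posrE ?exprn_gt0 ?ltr0n//; last by lia.
    by rewrite -natrX ler_nat ltnW// trunc_log_ltn.
  rewrite lnXn// -[ln 2 *+ _]mulr_natr ler_piMl//.
  by apply: le_trans (le_ln1Dx (x := 1) _) _.
have : (n.+1%:R <= 2 * n%:R :> R) by rewrite -natrM ler_nat; lia.
by lra.
Qed.

Theorem theorem3 (R : realType) :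
  (exists c : R, 0 < c /\
    forall eps delta : R, 0 < eps < 1 -> 0 < delta < 1 ->
    exists r0 : nat, forall r : nat, (r0 <= r)%N ->
    forall A : algorithm R, learns A (euclidean_family r) ->
    exists (I : instance R) (O : labeling I),
      [/\ euclidean_family r I, optimal O
        & may_query A eps delta O (c * r%:R)])
  /\
  (exists c : R, 0 < c /\
    forall eps delta : R, 0 < eps < 1 -> 0 < delta < 1 ->
    exists N0 : nat, forall N : nat, (N0 <= N)%N ->
    forall A : algorithm R, learns A (@finite_metric_family R) ->
    exists (I : instance R) (O : labeling I),
      [/\ finite_metric_family I, #|` fset_set (candidates I)| = N, optimal O
        & may_query A eps delta O (c * ln N%:R)]).
Proof.
split.
  (* The dimension [r] is the number of vertices, hence the constant 1. *)
  exists 1; split=> // eps delta eps01 delta01.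
  have [n0 [k [k_gt0 lb]]] := simplex_lower_bound eps01 delta01.
  exists n0 => r /lb/(_ setT (fun=> I))[nb {}lb] A learnsA.
  set J := simplex_instance _ _ in nb lb.
  have famJ : euclidean_family r J.
    by split=> //; exists (simplex R r), k, k_gt0.
  have [|L [opt mq]] := lb A; first by move=> L opt; exact: learnsA.
  by exists J, L; split=> //; rewrite mul1r.
exists 2^-1; split; first by rewrite invr_gt0.
move=> eps delta eps01 delta01.
have [n0 [k [k_gt0 lb]]] := simplex_lower_bound eps01 delta01.
(* The simplex will have dimension [trunc_log 2 N]; the exponent [n0.+1] keeps it positive even if
   [n0 = 0]. *)
exists (2 ^ n0.+1)%N => N N0N A learnsA.
have n0N : (n0 < trunc_log 2 N)%N by apply: trunc_log_max.
have N_ge2 : (2 <= N)%N.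
  by rewrite (leq_trans _ N0N)// expnS leq_pmulr ?expn_gt0.
have nN : (2 ^ trunc_log 2 N <= N)%N by apply: trunc_logP => //; exact: ltnW.
have [D cenD DN] := centroid_candidates R (leq_ltn_trans (leq0n _) n0N) nN.
have [nb lbN] := lb _ (ltnW n0N) [set` D] cenD.
set J := simplex_instance _ _ in nb lbN.
have famJ : finite_metric_family J by split=> //; exact: finite_fset.
have [|L [opt mq]] := lbN A; first by move=> L opt; exact: learnsA.
exists J, L; split=> //; first by rewrite /= set_fsetK.
exact: may_query_le (half_ln_le_trunc_log R N_ge2) mq.
Qed.
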